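(* Let $\mathtt{X}_N=(X_1,\dots,X_N)$ be an exchangeable vector of $\{0,1\}$-valued random variables and let $\gamma=\sum_{i=1}^N X_i$. Assume that the distribution of $\gamma$ is symmetric with respect to $N/2$, i.e. $P(\gamma=i)=P(\gamma=N-i)$ for all $0\le i\le N$. Then: (a) the gambler's belief holds for $\mathtt{X}_N$ if and only if $\gamma$ is tighter than the Binomial$(N,1/2)$; (b) the reverse gambler's belief holds for $\mathtt{X}_N$ if and only if $\gamma$ is looser than the Binomial$(N,1/2)$.
   Context: Exchangeable: $P(X_1=x_1,\dots,X_N=x_N)=P(X_1=x_{\psi(1)},\dots,X_N=x_{\psi(N)})$ for every permutation $\psi$ of $\{1,\dots,N\}$ and every $(x_1,\dots,x_N)\in\{0,1\}^N$. Gambler's belief: the predictive probability of the next possible outcome is ordered inversely to the counts in the observed sample. That is, for every $n<N$, every $\mathtt{x}_n=(x_1,\dots,x_n)\in\{0,1\}^n$ with $P(X_1=x_1,\dots,X_n=x_n)>0$, and all $a,b\in\{0,1\}$: if $a$ occurs strictly more often than $b$ in $\mathtt{x}_n$, then $P(X_{n+1}=a\mid X_1=x_1,\dots,X_n=x_n)<P(X_{n+1}=b\mid X_1=x_1,\dots,X_n=x_n)$. Reverse gambler's belief: the predictive probability of the next possible outcome is ordered according to the counts in the observed sample. That is, the same condition with the conclusion replaced by $P(X_{n+1}=a\mid X_1=x_1,\dots,X_n=x_n)>P(X_{n+1}=b\mid X_1=x_1,\dots,X_n=x_n)$. For $\gamma\in\{0,1,\dots,N\}$ with distribution symmetric with respect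 to $N/2$, $\gamma$ is tighter than the Binomial$(N,1/2)$ if $\frac{P(\gamma=i)}{P(\gamma=i-1)}>\frac{N-i+1}{i}$ for $1\le i\le\lfloor N/2\rfloor$, and looser than the Binomial$(N,1/2)$ if $\frac{P(\gamma=i)}{P(\gamma=i-1)}<\frac{N-i+1}{i}$ for $1\le i\le\lfloor N/2\rfloor$.
   Formalization: As the ratios P(γ=i)/P(γ=i−1) may have zero denominators (e.g. N=4, P(γ=2)=1, where the gambler's belief holds but P(γ=1)/P(γ=0)=0/0), ''tighter'' and ''looser'' are read with p/0=+∞ for p>0 and impose no condition at an index i where the ratio is 0/0. *)

(* Defs.v *)
From HB Require Import structures.
From mathcomp Require Import all_boot all_order all_algebra all_fingroup.
From mathcomp Require Import all_classical all_reals all_analysis.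

Set Implicit Arguments.
Unset Strict Implicit.
Unset Printing Implicit Defensive.

Import Order.TTheory GRing.Theory Num.Theory.

Local Open Scope classical_set_scope.
Local Open Scope ring_scope.
Local Open Scope ereal_scope.

(* {0,1}-valued random variables take values in [bool] (true = 1, false = 0).
   Indices are 0-based: [X i] with [i : 'I_N] is the (i+1)-st variable. *)

Definition exchangeable d (T : measurableType d) (R : realType)
    (P : probability T R) (N : nat) (X : 'I_N -> {RV P >-> bool}) : Prop :=
  forall (psi : {perm 'I_N}) (x : N.-tuple bool),
    P [set w | forall i, X i w = tnth x i] =
    P [set w | forall i, X i w = tnth x (psi i)].

Definition prefix_event d (T : measurableType d) (R : realType)
    (P : probability T R) (N : nat) (X : 'I_N -> {RV P >-> bool})
    (n : nat) (ltnN : (n < N)%N) (x : n.-tuple bool) : set T :=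
  [set w | forall j : 'I_n, X (widen_ord (ltnW ltnN) j) w = tnth x j].

(* Meaningful for 0 < P B only. *)
Definition cond_prob d (T : measurableType d) (R : realType)
    (P : probability T R) (A B : set T) : \bar R :=
  P (A `&` B) / P B.

(* 0-based, [Ordinal ltnN] is the index of the variable following the first n. *)
Definition predictive d (T : measurableType d) (R : realType)
    (P : probability T R) (N : nat) (X : 'I_N -> {RV P >-> bool})
    (n : nat) (ltnN : (n < N)%N) (x : n.-tuple bool) (a : bool) : \bar R :=
  cond_prob P [set w | X (Ordinal ltnN) w = a] (prefix_event X ltnN x).

Definition gamblers_belief d (T : measurableType d) (R : realType)
    (P : probability T R) (N : nat) (X : 'I_N -> {RV P >-> bool}) : Prop :=
  forall (n : nat) (ltnN : (n < N)%N) (x : n.-tuple bool),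
    0 < P (prefix_event X ltnN x) ->
    forall a b : bool, (count_mem b x < count_mem a x)%N ->
      predictive X ltnN x a < predictive X ltnN x b.

Definition reverse_gamblers_belief d (T : measurableType d) (R : realType)
    (P : probability T R) (N : nat) (X : 'I_N -> {RV P >-> bool}) : Prop :=
  forall (n : nat) (ltnN : (n < N)%N) (x : n.-tuple bool),
    0 < P (prefix_event X ltnN x) ->
    forall a b : bool, (count_mem b x < count_mem a x)%N ->
      predictive X ltnN x a > predictive X ltnN x b.

Definition gamma d (T : measurableType d) (R : realType)
    (P : probability T R) (N : nat) (X : 'I_N -> {RV P >-> bool}) (w : T) : nat :=
  (\sum_(i < N) X i w)%N.

Definition symmetric_law d (T : measurableType d) (R : realType)
    (P : probability T R) (N : nat) (g : T -> nat) : Prop :=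
  forall i : nat, (i <= N)%N ->
    P [set w | g w = i] = P [set w | g w = (N - i)%N].

(* The ratio P(g = i) / P(g = i-1) is taken in the extended reals, where
   p / 0 = +oo for p > 0.  An index at which it reads 0 / 0 imposes no condition:
   the library would evaluate 0 / 0 to 0. *)
Definition tighter_than_binomial d (T : measurableType d) (R : realType)
    (P : probability T R) (N : nat) (g : T -> nat) : Prop :=
  forall i : nat, (1 <= i <= N./2)%N ->
    ~ (P [set w | g w = i] = 0 /\ P [set w | g w = i.-1] = 0) ->
    P [set w | g w = i] / P [set w | g w = i.-1] >
      ((N - i + 1)%N%:R / i%:R)%R%:E.

Definition looser_than_binomial d (T : measurableType d) (R : realType)
    (P : probability T R) (N : nat) (g : T -> nat) : Prop :=
  forall i : nat, (1 <= i <= N./2)%N ->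
    ~ (P [set w | g w = i] = 0 /\ P [set w | g w = i.-1] = 0) ->
    P [set w | g w = i] / P [set w | g w = i.-1] <
      ((N - i + 1)%N%:R / i%:R)%R%:E.

(* Main.v *)
(* Let [q k] be the common probability of the full sequences with [k] ones, so
   that P(gamma = k) = 'C(N, k) * q k, and a prefix of length [N - m] with [k]
   ones has probability [(Q^m q) k], where [(Q q) k = q k + q k.+1].  Comparing
   the binomial ratios, "tighter" says that [q] strictly decreases beyond its
   centre N/2, except where it vanishes, and "looser" says the same of [- q].
   The operator Q preserves both this shape and the symmetry of [q], while its
   centre moves to (N-1)/2.  The belief compares the values of [Q^m q] at two
   neighbouring counts on the same side of the centre. *)

Require Import Defs.
From HB Require Import structures.
From mathcomp Require Import all_boot all_order all_algebra all_fingroup.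
From mathcomp Require Import all_classical all_reals all_analysis.
From mathcomp Require Import zify ring lra.

Set Implicit Arguments.
Unset Strict Implicit.
Unset Printing Implicit Defensive.

Import Order.TTheory GRing.Theory Num.Theory.

Local Open Scope classical_set_scope.
Local Open Scope ring_scope.

(** * Symmetric sequences under the operator [pascal] *)

Definition pascal (R : pzRingType) (q : nat -> R) (k : nat) : R := q k + q k.+1.

Lemma iter_pascalN (R : pzRingType) (q : nat -> R) m k :
  iter m (@pascal R) (fun i => - q i) k = - iter m (@pascal R) q k.
Proof. by elim: m k => //= m IHm k; rewrite /pascal !IHm -opprD. Qed.

Definition sym_about (R : Type) (N : nat) (q : nat -> R) : Prop :=
  forall i, (i <= N)%N -> q i = q (N - i)%N.

(* The second alternative accounts for conditioning events of probability 0 and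
   for ratios of the form 0 / 0. *)
Definition falling (R : realDomainType) (N : nat) (q : nat -> R) : Prop :=
  forall i, (N <= i.*2)%N -> (i < N)%N ->
    q i.+1 < q i \/ (q i.+1 = 0 /\ q i = 0).

Lemma sym_about_pascal (R : pzRingType) N (q : nat -> R) :
  sym_about N.+1 q -> sym_about N (pascal q).
Proof.
move=> qsym i iN; rewrite /pascal addrC.
by rewrite [q i]qsym ?[q i.+1]qsym ?subSS ?subSn// ltnW.
Qed.

(** The increment of [pascal q] at [i] is the sum of the increments of [q] at [i] and [i.+1]. Both
    are falling steps unless [N = i.*2]; in that case symmetry gives [q i = q i.+1] and only the
    second increment is left. *)
Lemma falling_pascal (R : realDomainType) N (q : nat -> R) :
  sym_about N.+1 q -> falling N.+1 q -> falling N (pascal q).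
Proof.
move=> qsym qfall i Ni iN; rewrite /pascal.
have := qfall i.+1 ltac:(lia) ltac:(lia).
have [NSi|NSi] := leqP N.+1 i.*2; first by have := qfall i NSi ltac:(lia); lra.
by rewrite (qsym i ltac:(lia)) (_ : N.+1 - i = i.+1)%N; [lra | lia].
Qed.

Lemma iter_pascal_falling (R : realDomainType) N m (q : nat -> R) :
  sym_about (m + N) q -> falling (m + N) q ->
  sym_about N (iter m (@pascal R) q) /\ falling N (iter m (@pascal R) q).
Proof.
elim: m N => //= m IHm N; rewrite addSnnS => qsym qfall.
have [qsym' qfall'] := IHm N.+1 qsym qfall.
by split; [exact: sym_about_pascal | exact: falling_pascal].
Qed.

Lemma count_mem_negb (s : seq bool) :
  (count_mem true s + count_mem false s = size s)%N.
Proof.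
by rewrite -(count_predC (pred1 true) s); congr (_ + _)%N; apply: eq_count; case.
Qed.

Lemma falling_count (R : realDomainType) (h : nat -> R) (s : seq bool) a b :
  sym_about (size s).+1 h -> falling (size s).+1 h ->
  (count_mem b s < count_mem a s)%N ->
  let next c := h (count_mem true (rcons s c)) in
  next a < next b \/ (next a = 0 /\ next b = 0).
Proof.
move=> hsym hfall ba next; have := count_mem_negb s.
rewrite /next -!cats1 !count_cat /= !addn0.
move: ba; case: a; case: b => //=; rewrite ?ltnn// ?addn0 ?addn1 => ba sz.
  by apply: hfall; lia.
have kN : (count_mem true s < size s)%N by move=> /=; lia.
(* Zeros are in the majority here. Reflecting both arguments replaces the number of ones by the
   number of zeros, which lies beyond the centre. *)
rewrite [h (count_mem true s)]hsym; last exact/leqW/ltnW.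
rewrite [h (count_mem true s).+1]hsym; last exact: ltnW.
by rewrite -sz !subSS addKn subSn ?leq_addr// addKn; apply: hfall; lia.
Qed.

(* For the converse, prefixes of length [N - 1] suffice. *)
Lemma falling_beliefP (R : realDomainType) N (q : nat -> R) :
  sym_about N q ->
  falling N q <->
  forall s : seq bool, (size s < N)%N -> forall a b,
    (count_mem b s < count_mem a s)%N ->
    let next c := iter (N - (size s).+1) (@pascal R) q (count_mem true (rcons s c)) in
    next a < next b \/ (next a = 0 /\ next b = 0).
Proof.
move=> qsym; split => [qfall s sN a b ba|belief i Ni iN].
  rewrite -(subnK sN) in qsym qfall.
  have [hsym hfall] := iter_pascal_falling qsym qfall.
  exact: falling_count hsym hfall ba.
(* Ones are in the majority since [N <= i.*2]; the operator is applied 0 times, so the two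
   continuations have values [q i.+1] and [q i]. *)
have := belief (nseq i true ++ nseq (N - i.+1) false) _ true false.
rewrite /= size_cat !size_nseq -!cats1 !count_cat !count_nseq /= !mul1n !mul0n.
rewrite (_ : N - (i + (N - i.+1)).+1 = 0)%N /= ?addn0 ?addn1; last lia.
by apply; lia.
Qed.

(** * Events fixing an initial segment, given as a list of any length *)

Definition starts d (T : measurableType d) (R : realType)
    (P : probability T R) (N : nat) (X : 'I_N -> {RV P >-> bool})
    (s : seq bool) : set T :=
  [set w | forall i : 'I_N, (i < size s)%N -> X i w = nth false s i].

Lemma measurable_starts d (T : measurableType d) (R : realType)
    (P : probability T R) (N : nat) (X : 'I_N -> {RV P >-> bool}) s :
  measurable (starts X s).
Proof.
rewrite (_ : starts X s = \bigcap_(i in [set i : 'I_N | (i < size s)%N])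
  (X i @^-1` [set nth false s i])); last by [].
apply: fin_bigcap_measurable => // i _.
rewrite -[X in measurable X]setTI; exact: measurable_funP.
Qed.

Lemma prefix_eventE d (T : measurableType d) (R : realType)
    (P : probability T R) (N : nat) (X : 'I_N -> {RV P >-> bool})
    n (nN : (n < N)%N) (x : n.-tuple bool) :
  prefix_event X nN x = starts X x.
Proof.
apply/seteqP; split=> w wx => [i|j].
  rewrite size_tuple => ix; have := wx (Ordinal ix).
  rewrite (tnth_nth false) /= => <-; congr (X _ w); exact/val_inj.
by rewrite wx ?size_tuple//= (tnth_nth false).
Qed.

Lemma starts_rcons d (T : measurableType d) (R : realType)
    (P : probability T R) (N : nat) (X : 'I_N -> {RV P >-> bool}) s
    (sN : (size s < N)%N) a :
  starts X (rcons s a) = [set w | X (Ordinal sN) w = a] `&` starts X s.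
Proof.
apply/seteqP; split=> w => [ws|[wa ws] i].
  split=> [|i si]; first by rewrite /= ws ?size_rcons//= nth_rcons ltnn eqxx.
  by rewrite ws ?size_rcons ?ltnS 1?ltnW// nth_rcons si.
rewrite size_rcons nth_rcons ltnS leq_eqVlt => /predU1P[si|si]; last by rewrite si ws.
by rewrite -si ltnn eqxx -wa; congr (X _ w); exact/val_inj.
Qed.

(** The value of the next variable splits the event in two. The factor [A] allows two uses: [setT]
    for prefix probabilities, and a level set of [gamma X] for the distribution of the sum. *)
Lemma fine_prob_split d (T : measurableType d) (R : realType)
    (P : probability T R) (N : nat) (X : 'I_N -> {RV P >-> bool}) s A :
  measurable A -> (size s < N)%N ->
  fine (P (A `&` starts X s)) = fine (P (A `&` starts X (rcons s false)))
    + fine (P (A `&` starts X (rcons s true))).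
Proof.
move=> mA sN; have mS c : measurable (A `&` starts X (rcons s c)).
  by apply: measurableI => //; exact: measurable_starts.
rewrite -fineD ?fin_num_measure// -measureU//; last first.
  apply/seteqP; split => // w [[_]].
  by rewrite !(starts_rcons X sN) => -[/= -> _] [_ []].
congr (fine (P _)); rewrite -setIUr !(starts_rcons X sN) -setIUl.
congr (A `&` _); rewrite -[LHS]setTI; congr (_ `&` _).
by apply/seteqP; split => //= w _; case E: (X (Ordinal sN) w); [right | left].
Qed.

(** This is the sequence [q] of the overview, read off the representative with all ones first. For
    [k > N] it repeats the value at [N], which is harmless because ['C(N, k)] is then 0. *)
Definition law d (T : measurableType d) (R : realType)
    (P : probability T R) (N : nat) (X : 'I_N -> {RV P >-> bool}) (k : nat) : R :=
  fine (P (starts X (nseq k true ++ nseq (N - k) false))).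

Lemma law_ge0 d (T : measurableType d) (R : realType)
    (P : probability T R) (N : nat) (X : 'I_N -> {RV P >-> bool}) k :
  0 <= law X k.
Proof. by rewrite fine_ge0. Qed.

(** Boolean lists of equal length with equally many ones are permutations of each other, so
    exchangeability identifies their probabilities. *)
Lemma fine_prob_full d (T : measurableType d) (R : realType)
    (P : probability T R) (N : nat) (X : 'I_N -> {RV P >-> bool}) s :
  exchangeable X -> size s = N ->
  fine (P (starts X s)) = law X (count_mem true s).
Proof.
move=> Xexch sN; rewrite /law; set k := count_mem true s.
set s0 := _ ++ _; have kN : (k <= N)%N by rewrite -sN count_size.
have s0N : size s0 == N by rewrite size_cat !size_nseq subnKC.
move/eqP: sN => sN.
have startsE (t : N.-tuple bool) : starts X t = [set w | forall i, X i w = tnth t i].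
  apply/seteqP; split=> w wt i; rewrite ?(tnth_nth false).
    by rewrite wt ?size_tuple.
  by rewrite wt (tnth_nth false).
have /tuple_permP[psi s0E] : perm_eq s0 (Tuple sN).
  have ct : count_mem true s0 = k.
    by rewrite count_cat !count_nseq /= mul1n mul0n addn0.
  apply/allP => -[] _ /=; rewrite ?ct//.
  have := count_mem_negb s; have := count_mem_negb s0.
  by rewrite ct (eqP sN) (eqP s0N) -/k => <- /addnI ->.
congr (fine _).
rewrite (startsE (Tuple sN)) (Xexch psi) (startsE (Tuple s0N)).
congr (P _); apply/seteqP; split=> w wt i; rewrite wt.
  by rewrite [RHS](tnth_nth false) /= s0E (nth_map i) ?size_enum_ord// nth_ord_enum.
by rewrite (tnth_nth false) /= s0E (nth_map i) ?size_enum_ord// nth_ord_enum.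
Qed.

(** Each variable not yet observed is summed out by one application of [pascal]. *)
Lemma fine_prob_starts d (T : measurableType d) (R : realType)
    (P : probability T R) (N : nat) (X : 'I_N -> {RV P >-> bool}) s :
  exchangeable X -> (size s <= N)%N ->
  fine (P (starts X s)) = iter (N - size s) (@pascal R) (law X) (count_mem true s).
Proof.
move=> Xexch; move mE : (N - size s)%N => m; elim: m s mE => [|m IHm] s mE sN /=.
  by rewrite fine_prob_full//; lia.
rewrite /pascal -[X in fine (P X)]setTI fine_prob_split//; last by lia.
rewrite !setTI !IHm ?size_rcons; try lia.
by rewrite -!cats1 !count_cat /= !addn0 addn1.
Qed.

(** * The distribution of the number of ones *)

Lemma gamma_starts d (T : measurableType d) (R : realType)
    (P : probability T R) (N : nat) (X : 'I_N -> {RV P >-> bool}) s w :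
  size s = N -> starts X s w -> gamma X w = count_mem true s.
Proof.
move=> sN ws; rewrite /gamma -sum1_count (big_nth false) sN big_mkord [RHS]big_mkcond.
by apply: eq_bigr => i _; rewrite ws ?sN//; case: nth.
Qed.

Lemma measurable_gamma d (T : measurableType d) (R : realType)
    (P : probability T R) (N : nat) (X : 'I_N -> {RV P >-> bool}) i :
  measurable [set w | gamma X w = i].
Proof.
rewrite (_ : [set _ | _] = \bigcup_(t in [set t : N.-tuple bool | count_mem true t = i])
  starts X t); first by apply: fin_bigcup_measurable => // t _; exact: measurable_starts.
apply/seteqP; split=> [w /= wi|w [t /= <- wt]]; last first.
  by apply: gamma_starts => //; rewrite size_tuple.
have wt : starts X [tuple X j w | j < N] w.
  by move=> j _; rewrite -tnth_nth tnth_mktuple.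
exists [tuple X j w | j < N] => //=; rewrite -wi.
by rewrite -(gamma_starts _ wt)// size_tuple.
Qed.

(** The coefficient counts the completions of [s] with [i] ones in total, and the induction on the
    number of free positions is Pascal's rule. The test guards against truncated subtraction, which
    would give the coefficient 1 when [s] already has more than [i] ones. *)
Lemma fine_prob_gamma_starts d (T : measurableType d) (R : realType)
    (P : probability T R) (N : nat) (X : 'I_N -> {RV P >-> bool}) s i :
  exchangeable X -> (size s <= N)%N ->
  fine (P ([set w | gamma X w = i] `&` starts X s)) =
  if (count_mem true s <= i)%N
  then 'C(N - size s, i - count_mem true s)%:R * law X i else 0.
Proof.
move=> Xexch; move mE : (N - size s)%N => m; elim: m s mE => [|m IHm] s mE sN.
  have {mE}sN : size s = N by lia.
  have [<-|si] := eqVneq (count_mem true s) i.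
    rewrite leqnn subnn bin0 mul1r -fine_prob_full//; congr (fine (P _)).
    by apply: setIidr => w; exact: gamma_starts.
  rewrite (_ : _ `&` _ = set0) ?measure0/=.
    by case: ifP => // lei; rewrite bin0n subn_eq0 leqNgt ltn_neqAle si lei mul0r.
  apply/seteqP; split=> // w [/= wi /(gamma_starts sN)].
  by rewrite wi => /esym/eqP; rewrite (negbTE si).
rewrite fine_prob_split//; [|exact: measurable_gamma|lia].
rewrite !IHm ?size_rcons; try lia.
rewrite -!cats1 !count_cat /= !addn0 addn1.
case: ltngtP => [si|si|->]; [|by rewrite addr0|by rewrite subnn !bin0 addr0].
by rewrite -mulrDl -natrD -(subSS _ i) subSn// binS.
Qed.

Lemma prob_gamma d (T : measurableType d) (R : realType)
    (P : probability T R) (N : nat) (X : 'I_N -> {RV P >-> bool}) i :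
  exchangeable X -> P [set w | gamma X w = i] = ('C(N, i)%:R * law X i)%:E.
Proof.
move=> Xexch; rewrite -[LHS]fineK; last first.
  by apply: fin_num_measure; exact: measurable_gamma.
have := fine_prob_gamma_starts (s := [::]) i Xexch (leq0n _).
rewrite /= !subn0 => <-; congr (fine (P _))%:E.
by rewrite (_ : starts X [::] = setT) ?setIT//; apply/seteqP; split.
Qed.

Lemma sym_about_law d (T : measurableType d) (R : realType)
    (P : probability T R) (N : nat) (X : 'I_N -> {RV P >-> bool}) :
  exchangeable X -> symmetric_law P N (gamma X) -> sym_about N (law X).
Proof.
move=> Xexch Xsym i iN; have := Xsym i iN; rewrite !prob_gamma// bin_sub// => -[].
by apply: mulfI; rewrite pnatr_eq0 -lt0n bin_gt0.
Qed.

(** * From the binomial ratio conditions to [falling] *)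

Lemma falling_lowerP (R : realDomainType) N (q : nat -> R) : sym_about N q ->
  falling N q <->
  forall i, (1 <= i <= N./2)%N -> q i.-1 < q i \/ (q i.-1 = 0 /\ q i = 0).
Proof.
(* Reflection about [N/2] exchanges descents beyond the centre with ascents below it, where the
   ratio conditions are stated. *)
move=> qsym; split=> [qfall [//|i] /= iN|qrise i Ni iN].
  have := qfall (N - i.+1)%N ltac:(lia) ltac:(lia).
  by rewrite (_ : (N - i.+1).+1 = N - i)%N -?qsym//; lia.
have := qrise (N - i)%N ltac:(lia).
by rewrite (qsym i ltac:(lia)) (qsym i.+1 ltac:(lia)) subnS.
Qed.

(** The threshold is the quotient of consecutive binomial coefficients, so it cancels from the ratio
    of probabilities and leaves a comparison of [law] at [i] and [i.-1]. *)
Lemma binomial_ratio (R : realFieldType) N i : (1 <= i <= N./2)%N ->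
  let r : R := (N - i + 1)%N%:R / i%:R in
  [/\ (0 < 'C(N, i.-1))%N, 'C(N, i)%:R = 'C(N, i.-1)%:R * r & 0 < r].
Proof.
case: i => // i /= iN; have {}iN : (i < N)%N by lia.
rewrite addn1 subnSK//; split; first by rewrite bin_gt0 ltnW.
  rewrite mulrA; apply: (canRL (mulfK _)); first by rewrite pnatr_eq0.
  by rewrite -!natrM mulnC mul_bin_left mulnC.
by rewrite divr_gt0// ltr0n subn_gt0.
Qed.

Lemma scaled_eq0 (R : realFieldType) (A B : nat) (r u v : R) :
  (0 < A)%N -> B%:R = A%:R * r -> 0 < r ->
  ((B%:R * u)%:E = 0 /\ (A%:R * v)%:E = 0)%E <-> v = 0 /\ u = 0.
Proof.
move=> A0 -> r0; split=> [[/eqP Bu /eqP Av]|[-> ->]]; last by rewrite !mulr0.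
move: Bu Av; rewrite !eqe !mulf_eq0 !pnatr_eq0 (gtn_eqF A0) (gt_eqF r0) /=.
by move=> /eqP -> /eqP ->.
Qed.

Lemma ediv_scaled (R : realFieldType) (A B : nat) (r u v : R) :
  (0 < A)%N -> B%:R = A%:R * r -> 0 < r -> 0 <= u -> ~ (v = 0 /\ u = 0) ->
  ((B%:R * u)%:E / (A%:R * v)%:E)%E = if v == 0 then +oo%E else (r * (u / v))%:E.
Proof.
move=> A0 BE r0 u0 nz; have {}A0 : 0 < A%:R :> R by rewrite ltr0n.
have [v_eq0|v_neq0] := eqVneq v 0.
  have u_gt0 : 0 < u by rewrite lt_def u0 andbT; apply/eqP => u_eq0; exact: nz.
  by rewrite v_eq0 mulr0 inve0 gt0_muley// lte_fin BE !mulr_gt0.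
rewrite inver mulf_eq0 (negbTE v_neq0) (gt_eqF A0) -EFinM BE; congr (_%:E).
by field; rewrite v_neq0 (gt_eqF A0).
Qed.

(** The excluded case 0 / 0 matches the second alternative. If only [v] vanishes, the ratio is [+oo]
    and [v < u] holds as well; otherwise [r] cancels. *)
Lemma ratio_gtP (R : realFieldType) (A B : nat) (r u v : R) :
  (0 < A)%N -> B%:R = A%:R * r -> 0 < r -> 0 <= u -> 0 <= v ->
  (~ ((B%:R * u)%:E = 0 /\ (A%:R * v)%:E = 0)%E ->
     (r%:E < (B%:R * u)%:E / (A%:R * v)%:E)%E) <->
  (v < u \/ (v = 0 /\ u = 0)).
Proof.
move=> A0 BE r0 u0 v0; rewrite (scaled_eq0 _ _ A0 BE r0).
have [z|nz] := pselect (v = 0 /\ u = 0); first by split=> // _; right.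
rewrite (ediv_scaled A0 BE)//; have [v_eq0|v_neq0] := eqVneq v 0.
  rewrite ltry; split => // _; left; rewrite v_eq0 lt_def u0 andbT.
  by apply/eqP => u_eq0; exact: nz.
have v_gt0 : 0 < v by rewrite lt_def v_neq0.
rewrite lte_fin -{1}[r]mulr1 ltr_pM2l// ltr_pdivlMr// mul1r.
by split=> [/(_ nz)|[//|/nz//]]; left.
Qed.

Lemma ratio_ltP (R : realFieldType) (A B : nat) (r u v : R) :
  (0 < A)%N -> B%:R = A%:R * r -> 0 < r -> 0 <= u -> 0 <= v ->
  (~ ((B%:R * u)%:E = 0 /\ (A%:R * v)%:E = 0)%E ->
     ((B%:R * u)%:E / (A%:R * v)%:E < r%:E)%E) <->
  (u < v \/ (v = 0 /\ u = 0)).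
Proof.
move=> A0 BE r0 u0 v0; rewrite (scaled_eq0 _ _ A0 BE r0).
have [z|nz] := pselect (v = 0 /\ u = 0); first by split=> // _; right.
rewrite (ediv_scaled A0 BE)//; have [v_eq0|v_neq0] := eqVneq v 0.
  (* Both sides fail: the ratio is [+oo], and [u < 0] contradicts [0 <= u]. *)
  by split=> [/(_ nz)//|[|/nz//]]; rewrite v_eq0 ltNge u0.
have v_gt0 : 0 < v by rewrite lt_def v_neq0.
rewrite lte_fin -{2}[r]mulr1 ltr_pM2l// ltr_pdivrMr// mul1r.
by split=> [/(_ nz)|[//|/nz//]]; left.
Qed.

Lemma tighterP d (T : measurableType d) (R : realType)
    (P : probability T R) (N : nat) (X : 'I_N -> {RV P >-> bool}) :
  exchangeable X -> symmetric_law P N (gamma X) ->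
  tighter_than_binomial P N (gamma X) <-> falling N (law X).
Proof.
move=> Xexch Xsym; rewrite (falling_lowerP (sym_about_law Xexch Xsym)).
split=> H i iN; have := H i iN; have [A0 BE r0] := binomial_ratio R iN.
  by rewrite !prob_gamma// => /(ratio_gtP A0 BE r0 (law_ge0 X _) (law_ge0 X _)).
by rewrite !prob_gamma// => /(ratio_gtP A0 BE r0 (law_ge0 X _) (law_ge0 X _)).
Qed.

Lemma looserP d (T : measurableType d) (R : realType)
    (P : probability T R) (N : nat) (X : 'I_N -> {RV P >-> bool}) :
  exchangeable X -> symmetric_law P N (gamma X) ->
  looser_than_binomial P N (gamma X) <-> falling N (fun k => - law X k).
Proof.
move=> Xexch Xsym; have qsym := sym_about_law Xexch Xsym.
rewrite falling_lowerP; last by move=> i iN; rewrite qsym.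
split=> H i iN; have := H i iN; have [A0 BE r0] := binomial_ratio R iN.
  rewrite !prob_gamma// => /(ratio_ltP A0 BE r0 (law_ge0 X _) (law_ge0 X _)); lra.
move=> {}H; rewrite !prob_gamma//.
apply/(ratio_ltP A0 BE r0 (law_ge0 X _) (law_ge0 X _)); lra.
Qed.

(** * Beliefs as comparisons of prefix probabilities *)

Lemma beliefP d (T : measurableType d) (R : realType)
    (P : probability T R) (N : nat) (X : 'I_N -> {RV P >-> bool})
    (r : rel R) (re : rel (\bar R)) :
  exchangeable X ->
  (forall c u v, 0 < c -> re (u / c)%:E (v / c)%:E = r u v) ->
  (forall n (nN : (n < N)%N) (x : n.-tuple bool), (0 < P (prefix_event X nN x))%E ->
    forall a b : bool, (count_mem b x < count_mem a x)%N ->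
      re (predictive X nN x a) (predictive X nN x b)) <->
  (forall s : seq bool, (size s < N)%N -> forall a b : bool,
    (count_mem b s < count_mem a s)%N ->
    let next c := iter (N - (size s).+1) (@pascal R) (law X)
                      (count_mem true (rcons s c)) in
    r (next a) (next b) \/ (next a = 0 /\ next b = 0)).
Proof.
(* Keeping [r] and [re] abstract serves both directions of the inequality; [rE] removes the common
   positive denominator of the two predictive probabilities. *)
move=> Xexch rE.
have nextE s c : (size s < N)%N ->
    iter (N - (size s).+1) (@pascal R) (law X) (count_mem true (rcons s c)) =
    fine (P (starts X (rcons s c))).
  by move=> sN; rewrite fine_prob_starts ?size_rcons.
have sum_next s a b : (size s < N)%N -> (count_mem b s < count_mem a s)%N ->
    fine (P (starts X s)) =
    fine (P (starts X (rcons s a))) + fine (P (starts X (rcons s b))).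
  move=> sN; rewrite -[X in fine (P X)]setTI fine_prob_split// !setTI.
  (* The strict inequality of counts forces [a] and [b] to be the two distinct values. *)
  by case: a; case: b; rewrite ?ltnn// addrC.
have PE s : P (starts X s) = (fine (P (starts X s)))%:E.
  by rewrite fineK// fin_num_measure//; exact: measurable_starts.
have predE n (nN : (n < N)%N) (x : n.-tuple bool) c :
    0 < fine (P (starts X x)) ->
    predictive X nN x c =
    (fine (P (starts X (rcons x c))) / fine (P (starts X x)))%:E.
  move=> x0; rewrite /predictive /cond_prob prefix_eventE.
  have xN : (size x < N)%N by rewrite size_tuple.
  have /esym := starts_rcons X xN c; rewrite (_ : Ordinal xN = Ordinal nN).
    by move=> ->; rewrite PE [P (starts X x)]PE inver gt_eqF.
  by apply: val_inj; rewrite /= size_tuple.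
have next_ge0 s : 0 <= fine (P (starts X s)) by rewrite fine_ge0.
split=> [belief s sN a b ba next|belief n nN x].
  rewrite /next !nextE//.
  (* A prefix of probability 0 carries no belief, but its two extensions then have probability 0
     too, which is the second alternative. *)
  have [s0|s0] := eqVneq (fine (P (starts X s))) 0.
    right; have := sum_next s a b sN ba; have := next_ge0 (rcons s a).
    by have := next_ge0 (rcons s b); rewrite s0; lra.
  left; have {}s0 : 0 < fine (P (starts X s)) by rewrite lt_def s0 next_ge0.
  have := belief _ sN (in_tuple s); rewrite prefix_eventE PE lte_fin => /(_ s0 a b ba).
  by rewrite !predE//= rE.
rewrite prefix_eventE PE lte_fin => x0 a b ba; rewrite !predE// rE//.
have xN : (size x < N)%N by rewrite size_tuple.
have := belief x xN a b ba; rewrite /= !nextE// => -[//|[a0 b0]].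
by move: x0; rewrite (sum_next _ _ _ xN ba) a0 b0 addr0 ltxx.
Qed.

Theorem theorem1 (d : measure_display) (T : measurableType d) (R : realType)
    (P : probability T R) (N : nat) (X : 'I_N -> {RV P >-> bool})
    (Xexch : exchangeable X) (gamma_sym : symmetric_law P N (gamma X)) :
  (gamblers_belief X <-> tighter_than_binomial P N (gamma X)) /\
  (reverse_gamblers_belief X <-> looser_than_binomial P N (gamma X)).
Proof.
have qsym := sym_about_law Xexch gamma_sym.
have nqsym : sym_about N (fun k => - law X k) by move=> i iN; rewrite qsym.
rewrite (tighterP Xexch gamma_sym) (looserP Xexch gamma_sym).
rewrite (falling_beliefP qsym) (falling_beliefP nqsym); split.
  by apply: beliefP => // c u v c0; rewrite lte_fin ltr_pM2r// invr_gt0.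
apply: (iff_trans (beliefP (r := fun u v => v < u) (re := fun u v => (v < u)%E) Xexch _)).
  by move=> c u v c0; rewrite lte_fin ltr_pM2r// invr_gt0.
(* The iterated operator commutes with negation, so the condition on [- law] is the reversed
   comparison for [law]. *)
by split=> H s sN a b ba; have := H s sN a b ba; rewrite /= !iter_pascalN; lra.
Qed.
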